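(* Let $0<a<b<c$ be real numbers. For $j,k\in\mathbb{N}$ put $v_j:=\{(j,m):m\in\mathbb{N}\}$ and $h_k:=\{(n,k):n\in\mathbb{N}\}$. (i) For each $j\in\mathbb{N}$, there exist $X,Y\sim \mathrm{Unif}\{a,b,c\}$ such that $\mathcal{U}(X,Y)=v_j$. (ii) For each $k\in\mathbb{N}$, there exist $X,Y\sim \mathrm{Unif}\{a,b,c\}$ such that $\mathcal{U}(X,Y)=h_k$. (iii) For each $(j,k)\in\mathbb{N}^2$, there exist $X,Y\sim \mathrm{Unif}\{a,b,c\}$ such that $\mathcal{U}(X,Y)=v_j\cup h_k$.
   Context: $\mathbb{N}=\{1,2,3,\dots\}$. For a random vector $(X,Y)$ whose components have finite moments of all orders, the uncorrelatedness set is $\mathcal{U}(X,Y)=\{(j,k)\in\mathbb{N}^2: \mathbf{E}[X^jY^k]=\mathbf{E}[X^j]\,\mathbf{E}[Y^k]\}$. $X\sim\mathrm{Unif}\{a,b,c\}$ means that $X$ takes each of the three values $a,b,c$ with probability $1/3$; ''$X,Y\sim \mathrm{Unif}\{a,b,c\}$'' means that $(X,Y)$ is a random vector (with an arbitrary joint distribution) both of whose marginals are $\mathrm{Unif}\{a,b,c\}$. *)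

(* Defs.v *)
From HB Require Import structures.
From mathcomp Require Import all_boot all_order all_algebra.
From mathcomp Require Import all_classical all_reals all_analysis.

Set Implicit Arguments.
Unset Strict Implicit.
Unset Printing Implicit Defensive.
Import Order.TTheory GRing.Theory Num.Theory.

Local Open Scope classical_set_scope.
Local Open Scope ring_scope.

(* The pairs of positive integers are encoded as the pairs of naturals both of
   whose components are nonzero. *)
Definition posnat : set nat := [set n | (0 < n)%N].

(* Expectations take values in the extended reals; the set has its intended
   meaning when X and Y have finite moments of all orders, in particular when
   they are almost surely finitely valued. *)
Definition uncorrelatedness_set (R : realType) (d : measure_display)
    (T : measurableType d) (P : probability T R) (X Y : {RV P >-> R}) :
    set (nat * nat) :=
  [set jk | [/\ posnat jk.1, posnat jk.2 &
    ('E_P[(fun w => X w ^+ jk.1 * Y w ^+ jk.2)%R] =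
     'E_P[(fun w => X w ^+ jk.1)%R] * 'E_P[(fun w => Y w ^+ jk.2)%R])%E]].

Arguments uncorrelatedness_set {R d T} P X Y.

(* Meant for pairwise distinct a, b, c: the three atoms then carry the whole
   mass of the law of X. *)
Definition unif3 (R : realType) (a b c : R) (d : measure_display)
    (T : measurableType d) (P : probability T R) (X : {RV P >-> R}) : Prop :=
  [/\ distribution P X [set a] = (3%:R^-1)%:E,
      distribution P X [set b] = (3%:R^-1)%:E &
      distribution P X [set c] = (3%:R^-1)%:E].

Arguments unif3 {R} a b c {d T} P X.

Definition vertical_line (j : nat) : set (nat * nat) :=
  [set nm | nm.1 = j /\ posnat nm.2].

Definition horizontal_line (k : nat) : set (nat * nat) :=
  [set nm | posnat nm.1 /\ nm.2 = k].

(* Main.v *)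
Require Import Defs.
From HB Require Import structures.
From mathcomp Require Import all_boot all_order all_algebra.
From mathcomp Require Import all_classical all_reals all_analysis measurable_realfun.
From mathcomp Require Import ring lra.
Import Order.TTheory GRing.Theory Num.Theory.
Local Open Scope classical_set_scope.
Local Open Scope ring_scope.

(** Start from the uniform law on the nine points of the grid
    {a, b, c} x {a, b, c} and tilt the mass of the point (x_i, x_j) by the
    factor 1 + u_i v_j, where u and v are vectors of R^3 with entries in
    [-1, 1] and with zero sum.  The zero sums keep both marginals uniform, and
    the covariance of f(X) and g(Y) becomes the product of the two pairings
    (sum_i u_i f(x_i)) (sum_j v_j g(x_j)), up to the factor 1/9.  Hence (n, m)
    is an uncorrelated pair of exponents exactly when u annihilates
    (a^n, b^n, c^n) or v annihilates (a^m, b^m, c^m)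
    ([tilted_uncorrelatedness]): the uncorrelatedness set is a union of
    vertical lines prescribed by u and of horizontal lines prescribed by v.

    It remains to find a zero-sum vector that annihilates (a^n, b^n, c^n) for
    n = j and for no other n, and one that does so for no n at all.  For the
    latter (-1, 0, 1) works.  For the former take the cross product of
    (1, 1, 1) and (a^j, b^j, c^j); its pairing with (a^n, b^n, c^n) is the
    generalized Vandermonde determinant with exponents 0, j, n.  It vanishes
    only for n = j because the ratio (c^n - b^n) / (b^n - a^n) increases
    strictly with n ([gap_ratio_ltS]), which follows from a form of Bernoulli's
    inequality ([power_gap_lt]). *)

(** * Zero-sum vectors orthogonal to prescribed powers *)

Section PowerGaps.
Context {R : realFieldType}.

(** Bernoulli's inequality for b / x, cleared of denominators.  The same
    bound serves below and above b: x - b changes sign there, so it bounds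
    c^n - b^n from above for c > b and b^n - a^n from below for a < b. *)
Lemma power_gap_lt (x b : R) (n : nat) : 0 < x -> 0 < b -> x != b ->
  (0 < n)%N -> b * (x ^+ n - b ^+ n) < n%:R * (x ^+ n * (x - b)).
Proof.
move=> x0 b0 xb.
have step k : b * (x ^+ k * (x - b)) < x ^+ k.+1 * (x - b).
  have gap : x ^+ k.+1 * (x - b) = b * (x ^+ k * (x - b)) + x ^+ k * (x - b) ^+ 2.
    by rewrite exprSr; ring.
  rewrite gap ltrDl; apply: mulr_gt0; first exact: exprn_gt0.
  by rewrite exprn_even_gt0//= subr_eq0.
case: n => // n _; elim: n => [|n IHn].
  by have := step 0; rewrite !expr0 expr1 !mul1r.
have -> : b * (x ^+ n.+2 - b ^+ n.+2) =
    b * (x ^+ n.+1 * (x - b)) + b * (b * (x ^+ n.+1 - b ^+ n.+1)).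
  by rewrite [x ^+ n.+2]exprSr [b ^+ n.+2]exprSr; ring.
rewrite [n.+2%:R]mulrS mulrDl mul1r ltrD//.
rewrite (lt_trans (y := b * (n.+1%:R * (x ^+ n.+1 * (x - b)))))// ?ltr_pM2l//.
by rewrite mulrCA ltr_pM2l// ltr0n.
Qed.

Variables a b c : R.
Hypotheses (a0 : 0 < a) (ab : a < b) (bc : b < c).
Let b0 : 0 < b := lt_trans a0 ab.
Let c0 : 0 < c := lt_trans b0 bc.

Lemma gap_gt0 n : (0 < n)%N -> (0 < b ^+ n - a ^+ n) * (0 < c ^+ n - b ^+ n).
Proof.
by move=> n0; rewrite !subr_gt0 !ltrXn2r ?ltW// -?lt0n.
Qed.

Definition gap_ratio n := (c ^+ n - b ^+ n) / (b ^+ n - a ^+ n).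

(** Passing from n to n + 1 turns the ratio C / B into
    (b C + c^n (c - b)) / (b B + a^n (b - a)), a mediant.  It is larger because
    [power_gap_lt] separates C / (c^n (c - b)) from B / (a^n (b - a)) by the
    common value n / b. *)
Lemma gap_ratio_ltS n : (0 < n)%N -> gap_ratio n < gap_ratio n.+1.
Proof.
move=> n0; have [g1 g2] := gap_gt0 n n0; have [h1 h2] := gap_gt0 n.+1 isT.
rewrite /gap_ratio ltr_pdivrMr// mulrAC ltr_pdivlMr//.
have ne1 : a != b by rewrite lt_eqF.
have ne2 : c != b by rewrite gt_eqF.
have L := power_gap_lt _ _ _ a0 b0 ne1 n0.
have U := power_gap_lt _ _ _ c0 b0 ne2 n0.
have an := exprn_gt0 n a0; have cn := exprn_gt0 n c0.
have U' : b * ((c ^+ n - b ^+ n) * (a ^+ n * (b - a))) <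
   n%:R * (c ^+ n * (c - b)) * (a ^+ n * (b - a)).
  by rewrite mulrA ltr_pM2r// mulr_gt0// subr_gt0.
have L' : n%:R * (a ^+ n * (b - a)) * (c ^+ n * (c - b)) <
   b * (b ^+ n - a ^+ n) * (c ^+ n * (c - b)).
  rewrite ltr_pM2r; first by lra.
  by rewrite mulr_gt0// subr_gt0.
have : (c ^+ n - b ^+ n) * (a ^+ n * (b - a)) <
       (b ^+ n - a ^+ n) * (c ^+ n * (c - b)).
  rewrite -(ltr_pM2l b0); lra.
rewrite !exprSr; lra.
Qed.

Lemma gap_ratio_inj j n : (0 < j)%N -> (0 < n)%N ->
  gap_ratio j = gap_ratio n -> j = n.
Proof.
have lt : {homo (fun n => gap_ratio n.+1) : i j / (i < j)%N >-> i < j}.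
  by apply: homo_ltn lt_trans _ => i; exact: gap_ratio_ltS.
case: j n => [|j] [|n]// _ _ e; congr S.
by case: (ltngtP j n) => // /lt; rewrite e ltxx.
Qed.

(** The left-hand side is the determinant of the rows (1, 1, 1),
    (a^j, b^j, c^j) and (a^n, b^n, c^n), expanded along the last one. *)
Lemma alternant_eq0 j n : (0 < j)%N -> (0 < n)%N ->
  (c ^+ j - b ^+ j) * a ^+ n + (a ^+ j - c ^+ j) * b ^+ n +
    (b ^+ j - a ^+ j) * c ^+ n = 0 <-> n = j.
Proof.
move=> j0 n0; split=> [e|->]; last ring.
apply: gap_ratio_inj => //.
have [g1 g2] := gap_gt0 n n0; have [h1 h2] := gap_gt0 j j0.
apply/eqP; rewrite /gap_ratio eqr_div; try by rewrite gt_eqF.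
by apply/eqP/subr0_eq; rewrite -e; ring.
Qed.

(** The default value [c] serves as the third atom and keeps the values at all
    larger indices positive. *)
Definition atom (i : nat) : R := nth c [:: a; b] i.

(** Entries bounded by 1 and with zero sum are what makes a vector usable as a
    tilt of the uniform law: every factor 1 + u_i v_j is then nonnegative, and
    the marginals are preserved. *)
Definition is_weight (u : nat -> R) (A : set nat) : Prop :=
  [/\ forall i, `|u i| <= 1,
      \sum_(i < 3) u i = 0 &
      forall n, (0 < n)%N -> \sum_(i < 3) u i * atom i ^+ n = 0 <-> A n].

Lemma weight_of_exponent j : (0 < j)%N -> exists u, is_weight u [set j].
Proof.
move=> j0; have [g1 g2] := gap_gt0 j j0.
have cj : 0 < c ^+ j by rewrite exprn_gt0.
have aj : 0 < a ^+ j by rewrite exprn_gt0.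
(* The cross product of (1, 1, 1) and (a^j, b^j, c^j); dividing by c^j, the
   largest of the powers, brings its entries into [-1, 1]. *)
pose s := [:: c ^+ j - b ^+ j; a ^+ j - c ^+ j; b ^+ j - a ^+ j].
exists (fun i => nth 0 s i / c ^+ j); split.
- move=> i; rewrite normrM normfV (gtr0_norm cj) ler_pdivrMr// mul1r ler_norml.
  by apply/andP; case: i => [|[|[|i]]]; rewrite /= ?nth_nil; lra.
- by rewrite -mulr_suml !big_ord_recl big_ord0/= (_ : _ + _ = 0) ?mul0r//; ring.
move=> n n0; rewrite -[[set j] n]/(n = j) -(alternant_eq0 j n j0 n0).
rewrite !big_ord_recl big_ord0 /atom/= addr0 ![_ / _ * _]mulrAC -!mulrDl addrA.
split=> [/eqP|->]; last by rewrite mul0r.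
by rewrite mulf_eq0 invr_eq0 (gt_eqF cj) orbF => /eqP.
Qed.

Lemma weight_without_exponent : exists u, is_weight u set0.
Proof.
(* The pairing is c^n - a^n, which is positive. *)
exists (fun i => nth 0 [:: -1; 0; 1] i); split.
- by case=> [|[|[|i]]]; rewrite /= ?nth_nil ?normrN ?normr1 ?normr0.
- by rewrite !big_ord_recl big_ord0/=; ring.
move=> n n0; have [g1 g2] := gap_gt0 n n0.
by rewrite !big_ord_recl big_ord0 /atom/=; split=> // h; lra.
Qed.
End PowerGaps.

(** * Tilted uniform laws on a grid *)

Section GridLaw.
Context {R : realType}.

(** The atoms are indexed by pairs of naturals rather than placed in the plane:
    every function of one index is measurable, and the values attached to the
    indices can be chosen nonnegative everywhere, so that integrals of
    nonnegative functions suffice. *)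
Definition grid_measure (n : nat) (w : nat -> nat -> {nonneg R}) :=
  msum (fun i => msum (fun j => mscale (w i j) \d_((i, j) : nat * nat)) n) n.

HB.instance Definition _ n w := Measure.on (grid_measure n w).

Lemma ge0_integral_grid n w (f : nat * nat -> R) :
  measurable_fun setT f -> (forall z, 0 <= f z) ->
  (\int[grid_measure n w]_z (f z)%:E =
   (\sum_(i < n) \sum_(j < n) (w i j)%:num * f (i : nat, j : nat))%:E)%E.
Proof.
move=> mf f0.
have mF : measurable_fun setT (fun z => (f z)%:E) by exact/measurable_EFinP.
rewrite /grid_measure ge0_integral_measure_sum//; last first.
  by move=> z _; rewrite lee_fin.
rewrite -sumEFin; apply: eq_bigr => i _.
rewrite ge0_integral_measure_sum//; last by move=> z _; rewrite lee_fin.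
rewrite -sumEFin; apply: eq_bigr => j _.
rewrite ge0_integral_mscale//; last by move=> z _; rewrite lee_fin.
by rewrite integral_dirac// diracT mul1e.
Qed.

Section TiltedLaw.
Variables (n : nat) (u v : nat -> R).
Hypotheses (u1 : forall i, `|u i| <= 1) (v1 : forall j, `|v j| <= 1).
Hypotheses (u0 : \sum_(i < n.+1) u i = 0) (v0 : \sum_(j < n.+1) v j = 0).

Let tilt_ge0 i j : 0 <= (1 + u i * v j) / n.+1%:R ^+ 2.
Proof.
rewrite divr_ge0 ?exprn_ge0// -lerBlDl sub0r.
have : `|u i * v j| <= 1 by rewrite normrM mulr_ile1.
by rewrite ler_norml => /andP[].
Qed.

Definition tilt i j : {nonneg R} := NngNum (tilt_ge0 i j).

(** The perturbation has rank one, so its contribution to the integral of a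
    product f(i) g(j) factors. *)
Lemma sum_tilt (f g : nat -> R) :
  \sum_(i < n.+1) \sum_(j < n.+1) (tilt i j)%:num * (f i * g j) =
  ((\sum_(i < n.+1) f i) * (\sum_(j < n.+1) g j) +
   (\sum_(i < n.+1) u i * f i) * (\sum_(j < n.+1) v j * g j)) / n.+1%:R ^+ 2.
Proof.
rewrite !big_distrlr/= -big_split/= mulr_suml; apply: eq_bigr => i _.
rewrite -big_split/= mulr_suml; apply: eq_bigr => j _.
by rewrite mulrAC mulrDl mul1r mulrACA.
Qed.

Definition tilted_law := grid_measure n.+1 tilt.

HB.instance Definition _ := Measure.on tilted_law.

Let tilted_integral (f g : nat -> R) :
  (forall i, 0 <= f i) -> (forall j, 0 <= g j) ->
  (\int[tilted_law]_z (f z.1 * g z.2)%:E =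
  (((\sum_(i < n.+1) f i) * (\sum_(j < n.+1) g j) +
   (\sum_(i < n.+1) u i * f i) * (\sum_(j < n.+1) v j * g j)) /
     n.+1%:R ^+ 2)%:E)%E.
Proof.
move=> f0 g0; rewrite /tilted_law ge0_integral_grid ?sum_tilt//=.
  have m (h : nat -> R) : measurable_fun setT h by [].
  by apply: measurable_funM; exact: measurableT_comp.
by move=> z; rewrite mulr_ge0.
Qed.

Let tilted_lawT : tilted_law setT = 1%E.
Proof.
rewrite -[LHS]mul1e -integral_cst//.
have := tilted_integral (fun=> 1) (fun=> 1) (fun=> ler01) (fun=> ler01).
rewrite mulr1 => ->.
under [X in _ + X * _]eq_bigr do rewrite mulr1.
by rewrite u0 mul0r addr0 sumr_const card_ord -expr2 divff// expf_neq0.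
Qed.

HB.instance Definition _ :=
  Measure_isProbability.Build _ _ _ tilted_law tilted_lawT.

Definition tilted_probability : probability (nat * nat)%type R := tilted_law.

Lemma tilted_expectation (f g : nat -> R) :
  (forall i, 0 <= f i) -> (forall j, 0 <= g j) ->
  ('E_tilted_probability[(fun z => f z.1 * g z.2)%R] =
  (((\sum_(i < n.+1) f i) * (\sum_(j < n.+1) g j) +
   (\sum_(i < n.+1) u i * f i) * (\sum_(j < n.+1) v j * g j)) /
     n.+1%:R ^+ 2)%:E)%E.
Proof. by move=> f0 g0; rewrite unlock tilted_integral. Qed.

(** The marginals stay uniform: against a constant, the zero-sum vector [v]
    kills the perturbation. *)
Lemma tilted_expectation_fst (f : nat -> R) : (forall i, 0 <= f i) ->
  ('E_tilted_probability[(fun z => f z.1)%R] = ((\sum_(i < n.+1) f i) / n.+1%:R)%:E)%E.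
Proof.
move=> f0.
have := tilted_expectation f (fun=> 1) f0 (fun=> ler01).
under eq_fun do rewrite mulr1.
under [X in _ + _ * X]eq_bigr do rewrite mulr1.
move->; congr EFin.
by rewrite v0 mulr0 addr0 sumr_const card_ord expr2 -mulf_div divff// mulr1.
Qed.

Lemma tilted_expectation_snd (g : nat -> R) : (forall j, 0 <= g j) ->
  ('E_tilted_probability[(fun z => g z.2)%R] = ((\sum_(j < n.+1) g j) / n.+1%:R)%:E)%E.
Proof.
move=> g0.
have := tilted_expectation (fun=> 1) g (fun=> ler01) g0.
under eq_fun do rewrite mul1r.
under [X in _ + X * _]eq_bigr do rewrite mulr1.
move->; congr EFin.
by rewrite u0 mul0r addr0 sumr_const card_ord expr2 -mulf_div divff// mul1r.
Qed.
End TiltedLaw.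

Section Coordinates.
Variable x : nat -> R.

Definition fst_value (z : nat * nat) : R := x z.1.
Definition snd_value (z : nat * nat) : R := x z.2.

Let mx : measurable_fun setT x. Proof. by []. Qed.

Let mfst : measurable_fun setT fst_value.
Proof. exact: measurableT_comp. Qed.

Let msnd : measurable_fun setT snd_value.
Proof. exact: measurableT_comp. Qed.

HB.instance Definition _ := isMeasurableFun.Build _ _ _ _ fst_value mfst.
HB.instance Definition _ := isMeasurableFun.Build _ _ _ _ snd_value msnd.
End Coordinates.
End GridLaw.

Arguments tilted_expectation {R n u v u1 v1 u0} f g.
Arguments tilted_expectation_fst {R n u v u1 v1 u0} v0 f.
Arguments tilted_expectation_snd {R n u v u1 v1 u0} g.

(** * Uncorrelatedness sets of tilted laws *)

(** By [tilted_expectation] the moment E[X^j Y^k] exceeds E[X^j] E[Y^k] by a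
    ninth of the product of the pairings of [u] with the j-th powers and of [v]
    with the k-th powers, and this product vanishes iff one of its factors
    does. *)
Lemma tilted_uncorrelatedness {R : realType} (a b c : R) (A B : set nat)
    (u v : nat -> R) : 0 < a -> a < b -> b < c ->
    is_weight a b c u A -> is_weight a b c v B ->
  exists (d : measure_display) (T : measurableType d)
         (P : probability T R) (X Y : {RV P >-> R}),
    [/\ unif3 a b c P X, unif3 a b c P Y &
        uncorrelatedness_set P X Y =
        [set jk | [/\ posnat jk.1, posnat jk.2 & A jk.1 \/ B jk.2]]].
Proof.
move=> a0 ab bc [u1 u0 uA] [v1 v0 vB].
have ac := lt_trans ab bc.
pose x := atom a b c.
have x0 i : 0 <= x i.
  by case: i => [|[|i]]; rewrite /x/atom/= ?nth_nil ltW// ?(lt_trans a0).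
pose P := tilted_probability 2 u v u1 v1 u0.
have one_atom y : y \in [:: a; b; c] -> \sum_(i < 3) (x i == y)%:R = 1 :> R.
  rewrite !inE !big_ord_recl big_ord0 /x/atom/=.
  by move=> /or3P[] /eqP->; rewrite eqxx ?(lt_eqF ab) ?(lt_eqF bc) ?(lt_eqF ac)
    ?(gt_eqF ab) ?(gt_eqF bc) ?(gt_eqF ac) ?addr0 ?add0r.
have PX y : y \in [:: a; b; c] ->
    distribution P (fst_value x : {RV P >-> R}) [set y] = (3%:R^-1)%:E.
  move=> yabc; rewrite /distribution/= /pushforward -expectation_indic//.
  (* Read the mass of an atom as the expectation of an indicator. *)
  rewrite (_ : \1__ = fun z : nat * nat => (x z.1 == y)%:R); last first.
    apply/funext => z; rewrite indicE; congr (nat_of_bool _)%:R.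
    by apply/asboolP/eqP.
  rewrite (tilted_expectation_fst v0 (fun i => (x i == y)%:R))//.
  by rewrite one_atom// mul1r.
have PY y : y \in [:: a; b; c] ->
    distribution P (snd_value x : {RV P >-> R}) [set y] = (3%:R^-1)%:E.
  move=> yabc; rewrite /distribution/= /pushforward -expectation_indic//.
  rewrite (_ : \1__ = fun z : nat * nat => (x z.2 == y)%:R); last first.
    apply/funext => z; rewrite indicE; congr (nat_of_bool _)%:R.
    by apply/asboolP/eqP.
  rewrite (tilted_expectation_snd (fun i => (x i == y)%:R))//.
  by rewrite one_atom// mul1r.
exists _, _, P, (fst_value x), (snd_value x); split.
- by split; apply: PX; rewrite !inE eqxx ?orbT.
- by split; apply: PY; rewrite !inE eqxx ?orbT.
have xn n i : 0 <= x i ^+ n by rewrite exprn_ge0.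
have uncorrelatedE j k : posnat j -> posnat k ->
    uncorrelatedness_set P (fst_value x) (snd_value x) (j, k) <->
    A j \/ B k.
  move=> j0 k0; rewrite -(uA j j0) -(vB k k0) /uncorrelatedness_set/=.
  rewrite (tilted_expectation (fun i => x i ^+ j) (fun i => x i ^+ k))//.
  rewrite (tilted_expectation_fst v0 (fun i => x i ^+ j))//.
  rewrite (tilted_expectation_snd (fun i => x i ^+ k))//.
  rewrite -EFinM mulf_div -expr2.
  rewrite -/x; set U := \sum_(i < 3) u i * _; set V := \sum_(i < 3) v i * _.
  have sq_neq0 : (2.+1%:R ^+ 2 : R) != 0 by rewrite expf_neq0// pnatr_eq0.
  split=> [[_ _ []]|UV].
    move/(divIf sq_neq0) => /eqP; rewrite -subr_eq0 addrAC subrr add0r.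
    by rewrite mulf_eq0 => /orP[] /eqP; [left|right].
  split=> //; congr (_ / _)%:E.
  by case: UV => ->; rewrite ?mul0r ?mulr0 addr0.
apply/seteqP; split=> -[j k] [/= j0 k0] h; last exact/uncorrelatedE.
by split=> //; apply/uncorrelatedE.
Qed.

Theorem theorem2p6 (R : realType) (a b c : R)
    (ha : 0 < a) (hab : a < b) (hbc : b < c) :
  [/\ forall j : nat, posnat j ->
        exists (d : measure_display) (T : measurableType d)
               (P : probability T R) (X Y : {RV P >-> R}),
          [/\ unif3 a b c P X, unif3 a b c P Y &
              uncorrelatedness_set P X Y = vertical_line j],
      forall k : nat, posnat k ->
        exists (d : measure_display) (T : measurableType d)
               (P : probability T R) (X Y : {RV P >-> R}),
          [/\ unif3 a b c P X, unif3 a b c P Y &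
              uncorrelatedness_set P X Y = horizontal_line k] &
      forall j k : nat, posnat j -> posnat k ->
        exists (d : measure_display) (T : measurableType d)
               (P : probability T R) (X Y : {RV P >-> R}),
          [/\ unif3 a b c P X, unif3 a b c P Y &
              uncorrelatedness_set P X Y = vertical_line j `|` horizontal_line k]].
Proof.
have [w0 w0P] := weight_without_exponent a b c ha hab hbc.
have weight j := weight_of_exponent a b c ha hab hbc j.
split.
- move=> j j0; have [u uP] := weight j j0.
  have [d [T [P [X [Y [uX uY XY]]]]]] :=
    tilted_uncorrelatedness a b c _ _ _ _ ha hab hbc uP w0P.
  exists d, T, P, X, Y; split=> //; rewrite XY; apply/seteqP; split=> -[n m] /=.
    by move=> [_ m0 [->|]].
  by move=> [/= -> m0]; split=> //; left.
- move=> k k0; have [v vP] := weight k k0.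
  have [d [T [P [X [Y [uX uY XY]]]]]] :=
    tilted_uncorrelatedness a b c _ _ _ _ ha hab hbc w0P vP.
  exists d, T, P, X, Y; split=> //; rewrite XY; apply/seteqP; split=> -[n m] /=.
    by move=> [n0 _ [|->]].
  by move=> [n0 /= ->]; split=> //; right.
move=> j k j0 k0; have [u uP] := weight j j0; have [v vP] := weight k k0.
have [d [T [P [X [Y [uX uY XY]]]]]] :=
  tilted_uncorrelatedness a b c _ _ _ _ ha hab hbc uP vP.
exists d, T, P, X, Y; split=> //; rewrite XY; apply/seteqP; split=> -[n m] /=.
  by move=> [n0 m0 [->|->]]; [left|right].
by move=> [[/= -> m0]|[n0 /= ->]]; split=> //; [left|right].
Qed.
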